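(* Let $\mu$ be a complex Lie algebra law on $\mathbb{C}^n$ without center, i.e. $Z(\mu)=\{x\in\mathbb{C}^n : \mu(x,y)=0\ \forall y\in\mathbb{C}^n\}=\{0\}$. If $\mu$ is rigid over the variety $\mathrm{L}^n$ of Lie algebra laws on $\mathbb{C}^n$, then $\mu$ is also rigid over the variety $\mathrm{Leib}^n$ of Leibniz algebra laws on $\mathbb{C}^n$.
   Context: A Leibniz algebra law on $\mathbb{C}^n$ is a bilinear map $\mu:\mathbb{C}^n\times\mathbb{C}^n\to\mathbb{C}^n$ satisfying $\mu(x,\mu(y,z))=\mu(\mu(x,y),z)-\mu(\mu(x,z),y)$ for all $x,y,z$. Lie algebra laws are exactly the anticommutative Leibniz algebra laws. $\mathrm{Leib}^n$ and $\mathrm{L}^n\subseteq\mathrm{Leib}^n$ denote the sets of Leibniz, respectively Lie, algebra laws on $\mathbb{C}^n$, viewed via structure constants in a fixed basis as algebraic subsets of $\mathbb{C}^{n^3}$. $GL(n,\mathbb{C})$ acts on each by $(f,\mu)\mapsto f^{-1}\circ\mu\circ(f\times f)$; the orbit $\mathcal{O}(\mu)$ is the isomorphism class of $\mu$. Let $\mathcal{L}^n$ be one of these varieties. In the language of Nelson's internal set theory, a perturbation over $\mathcal{L}^n$ of a standard law $\mu\in\mathcal{L}^n$ is a law $\mu'\in\mathcal{L}^n$ such that $\mu'(x,y)-\mu(x,y)$ is infinitesimally small for all standard $x,y\in\mathbb{C}^n$, and $\mu$ is rigid over $\mathcal{L}^n$ if every perturbation of $\mu$ over $\mathcal{L}^n$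 is isomorphic to $\mu$. Equivalently, in classical terms, $\mu$ is rigid over $\mathcal{L}^n$ if the orbit $\mathcal{O}(\mu)$ is open in $\mathcal{L}^n$ (for the metric topology induced from $\mathbb{C}^{n^3}$). *)

(* Defs.v *)
From mathcomp Require Import all_boot all_order all_algebra.
From mathcomp Require Import sesquilinear.
From mathcomp Require Import complex.
From mathcomp Require Import boolp classical_sets reals topology normedtype.

Set Implicit Arguments.
Unset Strict Implicit.
Unset Printing Implicit Defensive.

Import Order.TTheory GRing.Theory Num.Theory.
Import numFieldNormedType.Exports.

Local Open Scope classical_set_scope.
Local Open Scope ring_scope.

(* R[i] has to be seen as a number field to receive its norm topology. *)
Definition Cplx (R : realType) : numClosedFieldType := R[i].

(* C^n is the space of row vectors, on which linear endomorphisms act by right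
   multiplication. *)
Notation bilinear_op R n :=
  {bilinear 'rV[Cplx R]_n -> 'rV[Cplx R]_n -> 'rV[Cplx R]_n}.

Definition Leib (R : realType) (n : nat) : set (bilinear_op R n) :=
  [set mu | forall x y z, mu x (mu y z) = mu (mu x y) z - mu (mu x z) y].

(* Under anticommutativity the Leibniz identity is the Jacobi identity. *)
Definition Lie (R : realType) (n : nat) : set (bilinear_op R n) :=
  [set mu | Leib mu /\ forall x y, mu x y = - mu y x].

Definition law_center (R : realType) (n : nat) (mu : bilinear_op R n) :
    set 'rV[Cplx R]_n :=
  [set x | forall y, mu x y = 0].

(* The (i, j) entry is the row of coordinates of mu(e_i, e_j), so that the
   topology of the matrix type is the usual one on C^(n^3). *)
Definition structure_constants (R : realType) (n : nat) (mu : bilinear_op R n) :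
    'M['rV[Cplx R]_n]_n :=
  \matrix_(i, j) mu (delta_mx 0 i) (delta_mx 0 j).

Definition law_orbit (R : realType) (n : nat) (mu : bilinear_op R n) :
    set (bilinear_op R n) :=
  [set nu : bilinear_op R n | exists2 f : 'M[Cplx R]_n, f \in unitmx &
    forall x y, nu x y = mu (x *m f) (y *m f) *m invmx f].

(* Openness is relative to L: [subspace] carries the induced topology on the
   image of L, and isolates the points outside that image.  It is thus meant
   for mu in an L that is stable under isomorphism. *)
Definition rigid (R : realType) (n : nat) (L : set (bilinear_op R n))
    (mu : bilinear_op R n) : Prop :=
  open (@structure_constants R n @` law_orbit mu
        : set (subspace (@structure_constants R n @` L))).

(* Main.v *)
Require Import Defs.
From mathcomp Require Import all_boot all_order all_algebra.
From mathcomp Require Import sesquilinear perm.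
From mathcomp Require Import boolp classical_sets reals topology normedtype.

Set Implicit Arguments.
Unset Strict Implicit.
Unset Printing Implicit Defensive.

Import Order.TTheory GRing.Theory Num.Theory.
Import numFieldNormedType.Exports.

Local Open Scope classical_set_scope.
Local Open Scope ring_scope.

(** Applying the Leibniz identity to [mu x (mu y z)] and to [mu x (mu z y)]
    and adding the results, everything on the right cancels: in every Leibniz
    algebra the elements [mu y z + mu z y] are killed by all left
    multiplications, i.e. they lie in the right annihilator.  Hence a Leibniz
    law with zero right annihilator is a Lie law ([Leib_faithful_Lie]).

    For a Lie law, the right annihilator is the center by anticommutativity,
    so every law isomorphic to [mu] has zero right annihilator
    ([law_orbit_right_faithful]).  On the other hand, having zero right
    annihilator means that a matrix which is linear in the structure constants
    has full row rank, which is an open condition ([open_full_rank]).  It thus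
    cuts out an open set [U] that contains the orbit of [mu] and in which
    Leibniz laws and Lie laws are the same, so that an orbit open among the
    Lie laws is open among the Leibniz laws. *)

Lemma continuous_det (T : topologicalType) (K : numFieldType) (n : nat)
    (F : T -> 'M[K]_n) :
  (forall i j, continuous (fun t => F t i j)) ->
  continuous (fun t => \det (F t)).
Proof.
move=> F_cont; rewrite /determinant.
apply: (continuous_big (op := +%R)) => [|s _]; first exact: add_continuous.
move=> t; apply: cvgM; first exact: cvg_cst.
apply: (@cvg_big K _ *%R 1) => [|i _]; first exact: mul_continuous.
exact: (F_cont i (s i) t).
Qed.

Lemma continuous_mulmxr (T : topologicalType) (K : numFieldType) (m n p : nat)
    (F : T -> 'M[K]_(m, n)) (C : 'M[K]_(n, p)) :
  (forall i j, continuous (fun t => F t i j)) ->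
  forall i j, continuous (fun t => (F t *m C) i j).
Proof.
move=> F_cont i j.
rewrite (_ : (fun t => _) = (fun t => \sum_k F t i k * C k j)); last first.
  by apply/funext => t; rewrite mxE.
apply: (continuous_big (op := +%R)) => [|k _]; first exact: add_continuous.
move=> t; apply: cvgM; last exact: cvg_cst.
exact: F_cont.
Qed.

(** The entries range over any topological space, because structure constants
    form a matrix whose entries are rows. *)
Lemma continuous_mx_entry (T : topologicalType) (m n : nat) i j :
  continuous (fun M : 'M[T]_(m, n) => M i j).
Proof.
move=> M A MA.
exists (fun i' j' => if (i' == i) && (j' == j) then A else setT).
  by move=> i' j'; case: ifP => [/andP[/eqP-> /eqP->] // | _]; exact: filterT.
by move=> N /(_ i j); rewrite !eqxx.
Qed.

Definition right_faithful (K : fieldType) (n : nat)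
    (nu : 'rV[K]_n -> 'rV[K]_n -> 'rV[K]_n) : Prop :=
  forall a, (forall x, nu x a = 0) -> a = 0.

(** The matrix of the linear map sending [a] to the family of all products
    [nu (e_i) a], as a function of the structure constants of [nu]. *)
Definition right_mul_mx (K : fieldType) (n : nat) (M : 'M['rV[K]_n]_n) :
    'M[K]_(n, n * n) :=
  \matrix_(j < n) mxvec (\matrix_(i < n) M i j).

(** The invertibility of [right_mul_mx M *m C] for some [C] says that
    [right_mul_mx M] has full row rank; in this form the condition is a union
    of nonvanishing loci of polynomials. *)
Definition full_rank (K : fieldType) (n : nat) : set 'M['rV[K]_n]_n :=
  \bigcup_(C in [set: 'M[K]_(n * n, n)])
    [set M | \det (right_mul_mx M *m C) != 0].

Lemma continuous_right_mul_mx (K : numFieldType) (n : nat) i k :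
  continuous (fun M : 'M['rV[K]_n]_n => right_mul_mx M i k).
Proof.
case/mxvec_indexP: k => p q.
rewrite (_ : (fun M => _) = (fun M : 'M['rV[K]_n]_n => M p i 0 q)); last first.
  by apply/funext => M; rewrite mxE mxvecE mxE.
move=> M; apply: (@continuous_comp _ 'rV[K]_n K (fun N : 'M['rV[K]_n]_n => N p i)
  (fun v => v 0 q)); exact: continuous_mx_entry.
Qed.

Lemma open_full_rank (K : numFieldType) (n : nat) : open (@full_rank K n).
Proof.
apply: bigcup_open => C _.
pose f (M : 'M['rV[K]_n]_n) : K := \det (right_mul_mx M *m C).
apply: (@open_comp _ K f [set x | x != 0]).
  move=> M _; apply/continuous_det/continuous_mulmxr.
  exact: continuous_right_mul_mx.
have -> : [set x : K | x != 0] = ~` [set 0].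
  by apply/seteqP; split=> x /=; [move/eqP | move=> ?; apply/eqP].
apply: closed_openC; apply: accessible_closed_set1.
exact/hausdorff_accessible/norm_hausdorff.
Qed.

Lemma mul_right_mul_mx (R : realType) (n : nat) (nu : bilinear_op R n) a :
  a *m right_mul_mx (structure_constants nu) =
    mxvec (\matrix_(i < n) nu (delta_mx 0 i) a).
Proof.
apply/rowP=> k; case/mxvec_indexP: k => p q; rewrite mxvecE !mxE.
rewrite [a in RHS]row_sum_delta linear_sumr summxE.
by apply: eq_bigr => j _; rewrite linearZr !mxE mxvecE !mxE.
Qed.

Lemma full_rankP (R : realType) (n : nat) (nu : bilinear_op R n) :
  full_rank (structure_constants nu) <-> right_faithful nu.
Proof.
split=> [[C _ /= det_neq0] a a_ann | nu_faithful].
  have aB0 : a *m right_mul_mx (structure_constants nu) = 0.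
    rewrite mul_right_mul_mx; apply/rowP=> k; case/mxvec_indexP: k => p q.
    by rewrite mxvecE !mxE a_ann mxE.
  have uBC : right_mul_mx (structure_constants nu) *m C \in unitmx.
    by rewrite unitmxE unitfE.
  by rewrite -(mulmxK uBC a) mulmxA aB0 !mul0mx.
have /row_freeP[C BC1] : row_free (right_mul_mx (structure_constants nu)).
  apply: inj_row_free => a; rewrite mul_right_mul_mx => aB0.
  apply: nu_faithful => x.
  rewrite [x]row_sum_delta linear_sumlz big1 // => i _.
  rewrite linearZl_LR; apply/rowP=> q; move/rowP/(_ (mxvec_index i q)): aB0.
  by rewrite mxvecE !mxE => ->; rewrite mulr0.
by exists C => //=; rewrite BC1 det1 oner_neq0.
Qed.

(** The right-hand side of the Leibniz identity is alternating in its last two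
    arguments, so symmetrised products are killed by left multiplications. *)
Lemma Leib_faithful_Lie (R : realType) (n : nat) (nu : bilinear_op R n) :
  Leib nu -> right_faithful nu -> Lie nu.
Proof.
move=> nu_Leib nu_faithful; split=> // y z.
apply/eqP; rewrite -addr_eq0; apply/eqP/nu_faithful => x.
by rewrite linearDr !nu_Leib addrC subrKA subrr.
Qed.

Lemma law_orbit_Lie (R : realType) (n : nat) (mu nu : bilinear_op R n) :
  Lie mu -> law_orbit mu nu -> Lie nu.
Proof.
move=> [mu_Leib muC] [f f_unit nuE]; split=> [x y z | x y].
  by rewrite !nuE !mulmxKV // mu_Leib mulmxBl.
by rewrite !nuE muC mulNmx.
Qed.

Lemma law_orbit_right_faithful (R : realType) (n : nat)
    (mu nu : bilinear_op R n) :
  Lie mu -> law_center mu = [set 0] -> law_orbit mu nu -> right_faithful nu.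
Proof.
move=> [_ muC] mu_center [f f_unit nuE] a a_ann.
have : law_center mu (a *m f).
  (* Every vector is of the form [y *m f], so nothing is lost by multiplying
     on the left by such vectors only. *)
  move=> y; rewrite muC -(mulmxKV f_unit y); apply/eqP.
  rewrite oppr_eq0 -(can_eq (mulmxK (etrans (unitmx_inv f) f_unit))).
  by rewrite -nuE a_ann mul0mx.
by rewrite mu_center /= => af0; rewrite -(mulmxK f_unit a) af0 mul0mx.
Qed.

Theorem theorem4 (R : realType) (n : nat) (mu : bilinear_op R n)
    (mu_Lie : Lie mu) (mu_centerless : law_center mu = [set 0])
    (mu_rigid : rigid (@Lie R n) mu) :
  rigid (@Leib R n) mu.
Proof.
have [V V_open V_Lie] := (open_subspaceP _ _).1 mu_rigid.
apply/open_subspaceP; exists (V `&` @full_rank (Cplx R) n).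
  exact: openI V_open (@open_full_rank (Cplx R) n).
apply/seteqP; split=> M [].
  move=> [VM M_full] [nu nu_Leib nuM]; subst M.
  have nu_Lie : Lie nu := Leib_faithful_Lie nu_Leib ((full_rankP nu).1 M_full).
  have : (V `&` (@structure_constants R n @` @Lie R n)) (structure_constants nu).
    by split=> //; exists nu.
  by rewrite V_Lie => -[orbit_nu _]; split=> //; exists nu.
move=> [nu nu_orbit <-] nu_Leib; split=> //; split.
  have nu_Lie := law_orbit_Lie mu_Lie nu_orbit.
  have : ((@structure_constants R n @` law_orbit mu) `&`
          (@structure_constants R n @` @Lie R n)) (structure_constants nu).
    by split; exists nu.
  by rewrite -V_Lie => -[].
by apply/full_rankP; exact: law_orbit_right_faithful mu_Lie mu_centerless _.
Qed.
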